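(* In the limit $n\to\infty$, the period (at the bifurcation point) of the periodic attractor of the Lorenz-96 model born at the first Hopf bifurcation of the trivial equilibrium for $F>0$ is given by $$T_\infty=\lim_{n\to\infty}2\pi\tan\left(\frac{\pi l_1(n)}{n}\right)=2\pi\tan\left(\tfrac12\arccos\left(\tfrac14\right)\right)\approx4.867.$$ Similarly, the quotient of $n$ with the wave number $l_1(n)$ satisfies $$\lim_{n\to\infty}\frac{n}{l_1(n)}=\frac{2\pi}{\arccos(\tfrac14)}\approx4.767.$$
   Context: The Lorenz-96 model of dimension $n$ with parameter $F\in\mathbb{R}$ is the system of ordinary differential equations $\dot x_j = x_{j-1}(x_{j+1}-x_{j-2})-x_j+F$, $j=1,\dots,n$, with indices taken modulo $n$. It has the trivial equilibrium $x_F=(F,\dots,F)$. With $$f(j,n)=\cos\tfrac{2\pi j}{n}-\cos\tfrac{4\pi j}{n},\qquad g(j,n)=-\sin\tfrac{2\pi j}{n}-\sin\tfrac{4\pi j}{n},$$ the eigenvalues of the Jacobian matrix at $x_F$ for $n\ge4$ are $\lambda_j(F,n)=-1+F f(j,n)+iF g(j,n)$, $j=0,\dots,n-1$. For integers $l$ with $0<l<\tfrac n2$, $l\ne\tfrac n3$, the conjugate pair $\{\lambda_l,\lambda_{n-l}\}$ has zero real part exactly at $F_{\mathrm H}(l,n)=1/f(l,n)$, where it equals $\pm i\omega_0$ with $\omega_0=\cos\tfrac{\pi l}{n}/\sin\tfrac{\pi l}{n}$. The period at the bifurcation point of the periodic orbit born there is $T=2\pi/\omega_0=2\pi\tan\tfrac{\pi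 l}{n}$, and $l$ is its (spatial) wave number. The first such bifurcation for $F>0$ (the one with smallest positive $F_{\mathrm H}(l,n)$) occurs for the index $l_1(n)$, an integer $l$ with $0<l<n/3$ maximizing $f(l,n)$ (any maximizer, if it is not unique). *)

(* Defs.v *)
From Stdlib Require Import Reals Lra Lia.
From Coquelicot Require Import Coquelicot.
Open Scope R_scope.

(* A state (x_1, ..., x_n) is a function on nat of which only the values at
   0, ..., n-1 matter; the index n is represented by 0.  The truncated
   subtractions are harmless for n >= 2. *)
Definition state := nat -> R.

Definition lorenz96 (n : nat) (F : R) (x : state) (j : nat) : R :=
  x ((j + n - 1) mod n)%nat * (x ((j + 1) mod n)%nat - x ((j + n - 2) mod n)%nat)
  - x j + F.

Definition trivial_equilibrium (F : R) : state := fun _ => F.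

Definition update (x : state) (k : nat) (t : R) : state :=
  fun i => if Nat.eqb i k then t else x i.

Definition jacobian (n : nat) (F : R) (x : state) (j k : nat) : R :=
  Derive (fun t => lorenz96 n F (update x k t) j) (x k).

(* exp (- 2 pi i l k / n); the minus sign makes the mode l an eigenvector for
   the eigenvalue lambda_l = -1 + F f(l,n) + i F g(l,n), where
   g(l,n) = - sin (2 pi l / n) - sin (4 pi l / n). *)
Definition fourier_mode (n l k : nat) : C :=
  (cos (2 * PI * INR l * INR k / INR n),
   - sin (2 * PI * INR l * INR k / INR n)).

Definition mode_eigenvalue (n : nat) (F : R) (l : nat) (z : C) : Prop :=
  forall j, (j < n)%nat ->
    sum_n (fun k => Cmult (RtoC (jacobian n F (trivial_equilibrium F) j k))
                          (fourier_mode n l k)) (n - 1)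
    = Cmult z (fourier_mode n l j).

Definition f (l n : nat) : R :=
  cos (2 * PI * INR l / INR n) - cos (4 * PI * INR l / INR n).

Definition hopf_value (l n : nat) : R := 1 / f l n.

(* The eigenvalues of the modes l and n - l form the pair {i omega, - i omega}. *)
Definition critical_pair (n l : nat) (F omega : R) : Prop :=
  0 < omega /\
  exists z : C,
    mode_eigenvalue n F l z /\ mode_eigenvalue n F (n - l) (Cconj z) /\
    (z = Cmult Ci (RtoC omega) \/ z = Copp (Cmult Ci (RtoC omega))).

(* The period, at the bifurcation point, of the periodic orbit of wave
   number l. *)
Definition hopf_period (n l : nat) (T : R) : Prop :=
  exists omega : R, critical_pair n l (hopf_value l n) omega /\ T = 2 * PI / omega.

(* The inequality 3 * l < n says l < n / 3.  The maximizer need not be unique: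
   f 2 12 = f 3 12 = 1 are both maximal for n = 12. *)
Definition first_hopf_index (n l : nat) : Prop :=
  (0 < l)%nat /\ (3 * l < n)%nat /\
  forall k, (0 < k)%nat -> (3 * k < n)%nat -> f k n <= f l n.

Lemma f_factor l n :
  f l n = (1 - cos (2 * PI * INR l / INR n)) * (1 + 2 * cos (2 * PI * INR l / INR n)).
Proof.
unfold f.
replace (4 * PI * INR l / INR n) with (2 * (2 * PI * INR l / INR n))
  by (unfold Rdiv; ring).
rewrite cos_2a_cos; ring.
Qed.

Lemma f_sign l n : (0 < l)%nat -> (2 * l < n)%nat ->
  ((3 * l < n)%nat -> 0 < f l n) /\ ((n <= 3 * l)%nat -> f l n <= 0).
Proof.
intros l0 ln; rewrite f_factor.
pose proof PI_RGT_0 as pi0.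
assert (L0 : 0 < INR l) by (apply lt_0_INR; lia).
assert (N0 : 0 < INR n) by (apply lt_0_INR; lia).
assert (LN : 2 * INR l < INR n)
  by (replace 2 with (INR 2) by reflexivity; rewrite <- mult_INR; apply lt_INR; lia).
set (a := 2 * PI * INR l / INR n).
assert (Ea : a * INR n = 2 * PI * INR l) by (unfold a; field; lra).
assert (a0 : 0 < a) by (apply Rmult_lt_reg_r with (INR n); [lra | nra]).
assert (a1 : a < PI) by (apply Rmult_lt_reg_r with (INR n); [lra | nra]).
assert (c1 : cos a < 1) by (rewrite <- cos_0; apply cos_decreasing_1; lra).
assert (E3 : cos (2 * (PI / 3)) = - 1 / 2) by (apply cos_2PI3).
split; intros H.
- assert (H3 : 3 * INR l < INR n)
    by (replace 3 with (INR 3) by (simpl; ring); rewrite <- mult_INR; apply lt_INR; lia).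
  assert (a < 2 * (PI / 3)) by (apply Rmult_lt_reg_r with (INR n); [lra | nra]).
  assert (cos (2 * (PI / 3)) < cos a) by (apply cos_decreasing_1; lra).
  apply Rmult_lt_0_compat; lra.
- assert (H3 : INR n <= 3 * INR l)
    by (replace 3 with (INR 3) by (simpl; ring); rewrite <- mult_INR; apply le_INR; lia).
  assert (2 * (PI / 3) <= a) by (apply Rmult_le_reg_r with (INR n); [lra | nra]).
  assert (cos a <= cos (2 * (PI / 3))) by (apply cos_decr_1; lra).
  nra.
Qed.

Lemma first_hopf_indexP n l :
  first_hopf_index n l <->
  (0 < l)%nat /\ (2 * l < n)%nat /\ (3 * l <> n)%nat /\ 0 < hopf_value l n /\
  forall k, (0 < k)%nat -> (2 * k < n)%nat -> (3 * k <> n)%nat ->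
    0 < hopf_value k n -> hopf_value l n <= hopf_value k n.
Proof.
assert (pos : forall k, (0 < k)%nat -> (2 * k < n)%nat ->
                0 < hopf_value k n -> (3 * k < n)%nat).
{ intros k k0 kn h.
  destruct (Nat.lt_ge_cases (3 * k) n) as [H|H]; [exact H|].
  pose proof (proj2 (f_sign k n k0 kn) H) as Hf.
  unfold hopf_value, Rdiv in h; rewrite Rmult_1_l in h.
  destruct Hf as [Hf|Hf].
  - apply Rinv_lt_0_compat in Hf; lra.
  - rewrite Hf, Rinv_0 in h; lra. }
unfold first_hopf_index; split.
- intros (l0 & l3 & H).
  assert (fl : 0 < f l n) by (apply f_sign; lia).
  repeat split; try lia.
  + unfold hopf_value; apply Rdiv_lt_0_compat; lra.
  + intros k k0 k2 k3 hk.
    pose proof (pos k k0 k2 hk) as k3'.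
    assert (fk : 0 < f k n) by (apply f_sign; lia).
    unfold hopf_value, Rdiv; rewrite !Rmult_1_l.
    apply Rinv_le_contravar; auto.
- intros (l0 & l2 & l3 & hl & H).
  pose proof (pos l l0 l2 hl) as l3'.
  repeat split; auto.
  intros k k0 k3.
  assert (fl : 0 < f l n) by (apply f_sign; lia).
  assert (fk : 0 < f k n) by (apply f_sign; lia).
  assert (hk : 0 < hopf_value k n) by (unfold hopf_value; apply Rdiv_lt_0_compat; lra).
  assert (Hk := H k k0 ltac:(lia) ltac:(lia) hk).
  unfold hopf_value, Rdiv in Hk; rewrite !Rmult_1_l in Hk.
  apply Rinv_le_contravar in Hk; [|apply Rinv_0_lt_compat; lra].
  rewrite !Rinv_inv in Hk; exact Hk.
Qed.

(* Main.v *)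
From Stdlib Require Import Reals Lra Lia.
From Coquelicot Require Import Coquelicot.
Require Import Defs.
Open Scope R_scope.

(** With a = 2 pi l / n, the parabola identity
      f l n = (1 - cos a) (1 + 2 cos a) = 9/8 - 2 (cos a - 1/4)^2
    shows that the first Hopf bifurcation picks the wave number whose cosine
    is closest to 1/4.  The angles 2 pi k / n form a grid of step 2 pi / n, so
    for large n some competitor k has its angle within 2 pi / n of acos (1/4); since cos is
    1-Lipschitz, the maximizer satisfies |cos a - 1/4| <= 2 pi / n
    ([first_hopf_cos_close]).  On [0, pi] the cosine is inverted by the
    continuous function acos, hence a tends to acos (1/4)
    ([angle_first_hopf_lim]).  The two limits follow by continuity, because the
    period is 2 pi tan (a / 2) and n / l = 2 pi / a.

    That the period is 2 pi tan (a / 2) comes from the Jacobian at the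
    trivial equilibrium: it is circulant, so the Fourier modes diagonalize it
    and the eigenvalue of a mode is determined by its component 0
    ([mode_eigenvalueP]).  At F = 1 / f l n the real part vanishes, and
    sum-to-product formulas, in which the common factor sin (3a/2) cancels,
    reduce the imaginary part to - cos (a/2) / sin (a/2) ([lambda_hopf]).

    For the decimal values, pi and acos (1/4) are enclosed by evaluating Taylor
    bounds of cos, and tan (acos (1/4) / 2) is the square root of 3/5. *)

(** * The Jacobian at the trivial equilibrium *)

Definition kronecker (i k : nat) : R := if Nat.eqb i k then 1 else 0.

Lemma is_derive_update (x : state) (i k : nat) (t : R) :
  is_derive (fun t => update x k t i) t (kronecker i k).
Proof.
unfold update, kronecker; destruct (Nat.eqb i k).
- apply (is_derive_id (K := R_AbsRing)).
- apply (is_derive_const (K := R_AbsRing) (V := R_NormedModule)).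
Qed.

Lemma update_trivial_equilibrium (F : R) (i k : nat) :
  update (trivial_equilibrium F) k F i = F.
Proof. unfold update; destruct (Nat.eqb i k); reflexivity. Qed.

(** The derivative of the factor x (j - 1) contributes nothing: it is
    multiplied by the difference F - F. *)
Lemma jacobian_trivial_equilibrium (n : nat) (F : R) (j k : nat) :
  jacobian n F (trivial_equilibrium F) j k =
  F * kronecker ((j + 1) mod n) k - F * kronecker ((j + n - 2) mod n) k
  - kronecker j k.
Proof.
unfold jacobian; apply is_derive_unique; unfold lorenz96.
change (trivial_equilibrium F k) with F.
pose proof (fun i => is_derive_update (trivial_equilibrium F) i k F) as D.
evar_last.
- apply (is_derive_plus (K := R_AbsRing) (V := R_NormedModule)).
  + apply (is_derive_minus (K := R_AbsRing) (V := R_NormedModule)).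
    * apply (is_derive_mult (K := R_AbsRing)).
      -- apply D.
      -- apply (is_derive_minus (K := R_AbsRing) (V := R_NormedModule)); apply D.
      -- intros; apply Rmult_comm.
    * apply D.
  + apply (is_derive_const (K := R_AbsRing) (V := R_NormedModule)).
- unfold plus, minus, mult, opp, zero; simpl.
  unfold plus, opp; simpl; rewrite !update_trivial_equilibrium; ring.
Qed.

(** * Eigenvalues of the Fourier modes *)

(** Multiplies a vector by a matrix row with at most three nonzero entries.
    The positions may coincide, so no case distinction on how j - 2, j and j + 1
    wrap around modulo n is needed. *)
Lemma sum_three_kronecker (p q r : R) (a b c : nat) (v : nat -> C) (m : nat) :
  (a <= m)%nat -> (b <= m)%nat -> (c <= m)%nat ->
  sum_n (fun k => Cmult (RtoC (p * kronecker a k + q * kronecker b k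
                               + r * kronecker c k)) (v k)) m
  = Cplus (Cplus (Cmult (RtoC p) (v a)) (Cmult (RtoC q) (v b)))
          (Cmult (RtoC r) (v c)).
Proof.
(* A partial sum up to m sees the entry at i only if i <= m. *)
set (cut := fun i m => if Nat.leb i m then v i else RtoC 0).
intros am bm cm.
enough (H : sum_n (fun k => Cmult (RtoC (p * kronecker a k + q * kronecker b k
                               + r * kronecker c k)) (v k)) m
  = Cplus (Cplus (Cmult (RtoC p) (cut a m)) (Cmult (RtoC q) (cut b m)))
          (Cmult (RtoC r) (cut c m))).
{ rewrite H; unfold cut.
  now rewrite (proj2 (Nat.leb_le _ _) am), (proj2 (Nat.leb_le _ _) bm),
    (proj2 (Nat.leb_le _ _) cm). }
assert (cutO : forall i, cut i 0%nat = Cmult (RtoC (kronecker i 0)) (v 0%nat)).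
{ intros [|i]; unfold cut, kronecker; cbn [Nat.leb Nat.eqb]; ring. }
assert (cutS : forall i m, cut i (S m) =
          Cplus (cut i m) (Cmult (RtoC (kronecker i (S m))) (v (S m)))).
{ intros i k; unfold cut, kronecker.
  destruct (Nat.leb_spec i (S k)), (Nat.leb_spec i k), (Nat.eqb_spec i (S k));
    try lia; subst; ring. }
clear am bm cm; induction m as [|m IH].
- rewrite sum_O, !cutO, !RtoC_plus, !RtoC_mult.
  match goal with |- ?x = ?y => change (@eq C x y) end; ring.
- rewrite sum_Sn, IH, !cutS.
  change (@plus _) with Cplus.
  rewrite !RtoC_plus, !RtoC_mult.
  match goal with |- ?x = ?y => change (@eq C x y) end; ring.
Qed.

Definition angle (n l : nat) : R := 2 * PI * INR l / INR n.

Lemma fourier_mode_angle (n l k : nat) :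
  fourier_mode n l k = (cos (angle n l * INR k), - sin (angle n l * INR k)).
Proof.
unfold fourier_mode, angle.
replace (2 * PI * INR l * INR k / INR n) with (2 * PI * INR l / INR n * INR k)
  by (unfold Rdiv; ring).
reflexivity.
Qed.

Lemma angle_period (n l : nat) : (0 < n)%nat -> angle n l * INR n = 2 * INR l * PI.
Proof.
intros n0; unfold angle; field.
apply not_0_INR; lia.
Qed.

Lemma fourier_mode_mod (n l k : nat) : (0 < n)%nat ->
  fourier_mode n l (k mod n) = fourier_mode n l k.
Proof.
intros n0; rewrite !fourier_mode_angle.
assert (E : angle n l * INR k =
            angle n l * INR (k mod n) + 2 * INR (l * (k / n)) * PI).
{ rewrite (Nat.div_mod_eq k n) at 1.
  rewrite plus_INR, !mult_INR, Rmult_plus_distr_l, <- Rmult_assoc.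
  rewrite angle_period by exact n0; ring. }
now rewrite E, cos_period, sin_period.
Qed.

Definition lambda (n : nat) (F : R) (l : nat) : C :=
  (-1 + F * f l n, - F * (sin (angle n l) + sin (2 * angle n l))).

Lemma f_angle (l n : nat) : f l n = cos (angle n l) - cos (2 * angle n l).
Proof.
unfold f, angle.
now replace (4 * PI * INR l / INR n) with (2 * (2 * PI * INR l / INR n))
  by (unfold Rdiv; ring).
Qed.

(** Shifting the index by +1 and by -2 multiplies the mode by exp (- i a) and
    exp (2 i a), whose difference, scaled by F, gives both trigonometric
    terms of [lambda]. *)
Lemma mode_eigenvalue_lambda (n : nat) (F : R) (l : nat) : (2 <= n)%nat ->
  mode_eigenvalue n F l (lambda n F l).
Proof.
intros n2 j jn.
rewrite (sum_n_ext _ (fun k => Cmult (RtoC (F * kronecker ((j + 1) mod n) k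
    + - F * kronecker ((j + n - 2) mod n) k + -1 * kronecker j k))
    (fourier_mode n l k))).
2: { intros k; rewrite jacobian_trivial_equilibrium; do 2 f_equal; ring. }
pose proof (Nat.mod_upper_bound (j + 1) n ltac:(lia)).
pose proof (Nat.mod_upper_bound (j + n - 2) n ltac:(lia)).
rewrite sum_three_kronecker, !fourier_mode_mod, !fourier_mode_angle by lia.
rewrite minus_INR, !plus_INR by lia.
replace (angle n l * (INR j + INR 1)) with (angle n l * INR j + angle n l)
  by (simpl; ring).
replace (angle n l * (INR j + INR n - INR 2))
  with (angle n l * INR j - 2 * angle n l + 2 * INR l * PI)
  by (rewrite <- (angle_period n l) by lia; simpl; ring).
rewrite cos_period, sin_period.
unfold lambda; rewrite f_angle.
rewrite cos_plus, sin_plus, cos_minus, sin_minus.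
unfold Cmult, Cplus, RtoC; simpl; f_equal; ring.
Qed.

(** Uniqueness is read off component 0, where every mode equals 1. *)
Lemma mode_eigenvalueP (n : nat) (F : R) (l : nat) (z : C) : (2 <= n)%nat ->
  mode_eigenvalue n F l z <-> z = lambda n F l.
Proof.
intros n2; split; [intros Hz | intros ->; now apply mode_eigenvalue_lambda].
pose proof (mode_eigenvalue_lambda n F l n2 0%nat ltac:(lia)) as H0.
rewrite (Hz 0%nat ltac:(lia)) in H0.
rewrite fourier_mode_angle, Rmult_0_r, cos_0, sin_0, Ropp_0 in H0.
change (1, 0) with (RtoC 1) in H0.
now rewrite !Cmult_1_r in H0.
Qed.

(** The angles of the modes l and n - l are opposite modulo 2 pi. *)
Lemma lambda_conj (n : nat) (F : R) (l : nat) : (l <= n)%nat -> (0 < n)%nat ->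
  lambda n F (n - l) = Cconj (lambda n F l).
Proof.
intros ln n0.
assert (E : angle n (n - l) = - angle n l + 2 * INR 1 * PI).
{ unfold angle; rewrite minus_INR by exact ln; simpl; field.
  apply not_0_INR; lia. }
assert (E2 : 2 * angle n (n - l) = - (2 * angle n l) + 2 * INR 2 * PI).
{ rewrite E; simpl; ring. }
unfold lambda, Cconj; simpl; rewrite !f_angle, E2, E.
rewrite !cos_period, !sin_period, !cos_neg, !sin_neg.
f_equal; ring.
Qed.

(** * The period at the bifurcation *)

Lemma half_angle (n l : nat) : PI * INR l / INR n = angle n l / 2.
Proof. unfold angle, Rdiv; lra. Qed.

Lemma angle_bounds (n l : nat) : (0 < l)%nat -> (3 * l < n)%nat ->
  0 < angle n l < 2 * (PI / 3).
Proof.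
intros l0 ln.
pose proof PI_RGT_0.
assert (L0 : 0 < INR l) by (apply lt_0_INR; lia).
apply lt_INR in ln; rewrite mult_INR in ln; simpl in ln.
assert (E : angle n l * INR n = 2 * PI * INR l) by (unfold angle; field; lra).
split; apply Rmult_lt_reg_r with (INR n); nra.
Qed.

(** With h half the angle, both f l n = 2 sin (3h) sin h and the imaginary part,
    proportional to 2 sin (3h) cos h, contain sin (3h), which is nonzero because
    f l n is; the quotient is a cotangent. *)
Lemma lambda_hopf (n l : nat) : (0 < l)%nat -> (3 * l < n)%nat ->
  lambda n (hopf_value l n) l =
  Copp (Cmult Ci (RtoC (cos (angle n l / 2) / sin (angle n l / 2)))).
Proof.
intros l0 ln.
destruct (angle_bounds n l l0 ln) as [a0 a1].
assert (f0 : 0 < f l n) by (apply f_sign; lia).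
pose proof (f_angle l n) as Ef.
set (h := angle n l / 2) in *.
assert (s0 : 0 < sin h) by (apply sin_gt_0; unfold h; lra).
assert (E : angle n l = 2 * h) by (unfold h; field).
assert (Ec : f l n = 2 * sin (3 * h) * sin h).
{ rewrite Ef, E, form2.
  replace ((2 * h - 2 * (2 * h)) / 2) with (- h) by field.
  replace ((2 * h + 2 * (2 * h)) / 2) with (3 * h) by field.
  rewrite sin_neg; ring. }
assert (Es : sin (angle n l) + sin (2 * angle n l) = 2 * sin (3 * h) * cos h).
{ rewrite E, form3.
  replace ((2 * h - 2 * (2 * h)) / 2) with (- h) by field.
  replace ((2 * h + 2 * (2 * h)) / 2) with (3 * h) by field.
  rewrite cos_neg; ring. }
unfold lambda, hopf_value; rewrite Es.
assert (s3 : sin (3 * h) <> 0) by (intros s3; rewrite s3 in Ec; lra).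
unfold Copp, Cmult, Ci, RtoC; simpl; f_equal.
- field; lra.
- rewrite Ec; field; split; lra.
Qed.

(** The eigenvalue is - i cot h with cot h > 0; positivity of omega selects the
    sign in the definition of a critical pair. *)
Lemma critical_pairP (n l : nat) (omega : R) : (0 < l)%nat -> (3 * l < n)%nat ->
  critical_pair n l (hopf_value l n) omega <->
  omega = cos (angle n l / 2) / sin (angle n l / 2).
Proof.
intros l0 ln.
destruct (angle_bounds n l l0 ln) as [a0 a1].
assert (w0 : 0 < cos (angle n l / 2) / sin (angle n l / 2)).
{ apply Rdiv_lt_0_compat; [apply cos_gt_0 | apply sin_gt_0]; lra. }
pose proof (lambda_hopf n l l0 ln) as E.
split.
- intros (om0 & z & Hz & _ & Hom).
  apply mode_eigenvalueP in Hz; [|lia].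
  rewrite E in Hz; subst z.
  destruct Hom as [H|H]; apply (f_equal snd) in H; simpl in H; lra.
- intros ->; split; [exact w0|].
  exists (lambda n (hopf_value l n) l); repeat split.
  + apply mode_eigenvalue_lambda; lia.
  + rewrite <- lambda_conj by lia; apply mode_eigenvalue_lambda; lia.
  + now right.
Qed.

Lemma hopf_periodP (n l : nat) (T : R) : (0 < l)%nat -> (3 * l < n)%nat ->
  hopf_period n l T <-> T = 2 * PI * tan (PI * INR l / INR n).
Proof.
intros l0 ln; rewrite half_angle; unfold hopf_period, tan.
destruct (angle_bounds n l l0 ln) as [a0 a1].
assert (s0 : 0 < sin (angle n l / 2)) by (apply sin_gt_0; lra).
assert (c0 : 0 < cos (angle n l / 2)) by (apply cos_gt_0; lra).
split.
- intros (omega & Hom & ->).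
  apply critical_pairP in Hom; [|assumption..].
  subst omega; field; lra.
- intros ->; eexists; split; [now apply critical_pairP|].
  field; lra.
Qed.

(** * Convergence of the angle *)

(** Completing the square turns maximization of f into minimization of the
    distance from the cosine to 1/4. *)
Lemma f_parabola (l n : nat) : f l n = 9 / 8 - 2 * (cos (angle n l) - 1 / 4) ^ 2.
Proof. rewrite f_factor; fold (angle n l); field. Qed.

Lemma cos_lipschitz (x y : R) : Rabs (cos x - cos y) <= Rabs (x - y).
Proof.
destruct (MVT_abs cos (fun c => - sin c) y x) as (c & -> & _).
{ intros c _; apply derivable_pt_lim_cos. }
rewrite Rabs_Ropp.
pose proof (Rabs_pos (x - y)).
assert (Rabs (sin c) <= 1) by (apply Rabs_le, SIN_bound).
nra.
Qed.

Lemma acos_quarter_bounds : 0 < acos (1 / 4) < PI / 2.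
Proof.
pose proof (acos_bound_lt (1 / 4) ltac:(lra)) as [a0 a1].
split; [exact a0|].
apply cos_decreasing_0; try lra.
rewrite cos_PI2, cos_acos; lra.
Qed.

Lemma angle_approximation (n : nat) (a : R) : (0 < n)%nat -> 0 <= a ->
  exists k, angle n k <= a < angle n k + 2 * PI / INR n.
Proof.
intros n0 a0.
pose proof PI_RGT_0.
assert (N0 : 0 < INR n) by now apply lt_0_INR.
destruct (nfloor_ex (INR n * a / (2 * PI))) as [k [k1 k2]].
{ apply Rdiv_le_0_compat; nra. }
exists k; unfold angle.
assert (E : INR n * a / (2 * PI) * (2 * PI / INR n) = a) by (field; lra).
assert (P : 0 < 2 * PI / INR n) by (apply Rdiv_lt_0_compat; lra).
replace (2 * PI * INR k / INR n) with (INR k * (2 * PI / INR n)) by (field; lra).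
nra.
Qed.

(** The lower bound on n makes the grid step at most acos (1/4), so that the grid
    point just below acos (1/4) has a positive index; that index also
    satisfies 3 k < n because acos (1/4) < pi / 2 < 2 pi / 3. *)
Lemma first_hopf_cos_close (n l : nat) :
  first_hopf_index n l -> 2 * PI / acos (1 / 4) <= INR n ->
  Rabs (cos (angle n l) - 1 / 4) <= 2 * PI / INR n.
Proof.
intros (l0 & ln & lmax) nbig.
pose proof PI_RGT_0.
destruct acos_quarter_bounds as [a0 a1].
assert (N0 : 0 < INR n).
{ apply Rlt_le_trans with (2 := nbig), Rdiv_lt_0_compat; lra. }
assert (n0 : (0 < n)%nat) by now apply INR_lt.
destruct (angle_approximation n (acos (1 / 4)) n0 ltac:(lra)) as (k & k1 & k2).
assert (Ek : angle n k * INR n = 2 * PI * INR k) by (unfold angle; field; lra).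
assert (kpos : (0 < k)%nat).
{ destruct k as [|k]; [exfalso | lia].
  assert (Ea : 2 * PI / acos (1 / 4) * acos (1 / 4) = 2 * PI) by (field; lra).
  assert (En : 2 * PI / INR n * INR n = 2 * PI) by (field; lra).
  assert (angle n 0 = 0) by (unfold angle; simpl; field; lra).
  nra. }
assert (k3 : (3 * k < n)%nat).
{ apply INR_lt; rewrite mult_INR; simpl; nra. }
pose proof (lmax k kpos k3) as Hf; rewrite !f_parabola in Hf.
apply Rle_trans with (Rabs (cos (angle n k) - 1 / 4)).
- apply Rsqr_le_abs_0; unfold Rsqr; lra.
- rewrite <- (cos_acos (1 / 4)) at 1 by lra.
  eapply Rle_trans; [apply cos_lipschitz|].
  apply Rabs_le; lra.
Qed.

(** The angles lie in [0, pi], where acos inverts cos, so convergence of the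
    cosines to 1/4 passes to the angles by continuity of acos at 1/4. *)
Lemma angle_first_hopf_lim (l1 : nat -> nat) :
  (forall n, (4 <= n)%nat -> first_hopf_index n (l1 n)) ->
  is_lim_seq (fun n => angle n (l1 n)) (acos (1 / 4)).
Proof.
intros first.
assert (big : eventually (fun n => (4 <= n)%nat /\ 2 * PI / acos (1 / 4) <= INR n)).
{ apply filter_and; [now exists 4%nat|].
  destruct (nfloor_ex (2 * PI / acos (1 / 4))) as [N [_ HN]].
  { pose proof PI_RGT_0; destruct acos_quarter_bounds.
    apply Rdiv_le_0_compat; lra. }
  exists (S N); intros n Hn; apply le_INR in Hn; rewrite S_INR in Hn; lra. }
assert (err : is_lim_seq (fun n => 2 * PI / INR n) 0).
{ replace (Finite 0) with (Rbar_div (2 * PI) p_infty) by (simpl; f_equal; ring).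
  apply (is_lim_seq_div _ _ (2 * PI) p_infty);
    [apply is_lim_seq_const | apply is_lim_seq_INR | easy | easy]. }
assert (cosl : is_lim_seq (fun n => cos (angle n (l1 n)) - 1 / 4) 0).
{ apply is_lim_seq_abs_0.
  apply is_lim_seq_le_le_loc with (fun _ => 0) (fun n => 2 * PI / INR n);
    [|apply is_lim_seq_const | exact err].
  apply filter_imp with (2 := big); intros n [n4 nbig]; split; [apply Rabs_pos|].
  apply first_hopf_cos_close; auto. }
apply is_lim_seq_ext_loc with (fun n => acos (cos (angle n (l1 n)))).
- exists 4%nat; intros n n4.
  destruct (first n n4) as (l0 & ln & _).
  destruct (angle_bounds n (l1 n) l0 ln).
  apply acos_cos; lra.
- apply is_lim_seq_continuous.
  + apply derivable_continuous_pt, derivable_pt_acos; lra.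
  + apply is_lim_seq_ext with (fun n => cos (angle n (l1 n)) - 1 / 4 + 1 / 4).
    { intros n; ring. }
    replace (Finite (1 / 4)) with (Finite (0 + 1 / 4)) by (f_equal; ring).
    apply is_lim_seq_plus'; [exact cosl | apply is_lim_seq_const].
Qed.

(** * Numerical enclosures *)

Lemma cos_taylor_bounds (x : R) : 0 <= x <= 2 ->
  1 - x ^ 2 / 2 + x ^ 4 / 24 - x ^ 6 / 720 + x ^ 8 / 40320 - x ^ 10 / 3628800
  <= cos x <=
  1 - x ^ 2 / 2 + x ^ 4 / 24 - x ^ 6 / 720 + x ^ 8 / 40320 - x ^ 10 / 3628800
  + x ^ 12 / 479001600.
Proof.
intros x2.
destruct (pre_cos_bound x 2 ltac:(lra) ltac:(lra)) as [lo up].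
(* The factorials are obtained as reals one step at a time: 12! is far too
   large to be computed in unary. *)
assert (step : forall i c, INR (Factorial.fact (2 * i)) = c ->
  INR (Factorial.fact (2 * S i)) = (2 * INR i + 2) * ((2 * INR i + 1) * c)).
{ intros i c <-; replace (2 * S i)%nat with (S (S (2 * i))) by lia.
  rewrite !fact_simpl, !mult_INR, !S_INR, mult_INR; simpl; ring. }
pose proof (eq_refl : INR (Factorial.fact (2 * 0)) = 1) as E0.
pose proof (step _ _ E0) as E1; pose proof (step _ _ E1) as E2.
pose proof (step _ _ E2) as E3; pose proof (step _ _ E3) as E4.
pose proof (step _ _ E4) as E5; pose proof (step _ _ E5) as E6.
unfold cos_approx in lo, up.
change (2 * 2 + 1)%nat with 5%nat in lo.
change (2 * (2 + 1))%nat with 6%nat in up.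
cbn [sum_f_R0] in lo, up; unfold cos_term in lo, up.
rewrite E0, E1, E2, E3, E4, E5 in lo.
rewrite E0, E1, E2, E3, E4, E5, E6 in up.
clear step E0 E1 E2 E3 E4 E5 E6.
simpl in lo, up.
split.
- eapply Rle_trans; [|apply lo]; right; field.
- eapply Rle_trans; [apply up|]; right; field.
Qed.

(** The sign of cos changes at pi / 2, so the signs of the Taylor bounds at
    3.1415 / 2 and 3.1417 / 2 locate pi. *)
Lemma PI_bounds : 3.1415 < PI < 3.1417.
Proof.
pose proof PI2_1.
split; apply Rnot_le_lt; intros H1.
- assert (cos (3.1415 / 2) <= 0) by (apply cos_le_0; lra).
  destruct (cos_taylor_bounds (3.1415 / 2)); lra.
- assert (0 <= cos (3.1417 / 2)) by (apply cos_ge_0; lra).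
  destruct (cos_taylor_bounds (3.1417 / 2)); lra.
Qed.

Lemma acos_quarter_numeric : 1.3180 < acos (1 / 4) < 1.31815.
Proof.
destruct acos_quarter_bounds; pose proof PI_bounds.
split; apply cos_decreasing_0; try lra; rewrite cos_acos by lra.
- destruct (cos_taylor_bounds 1.3180); lra.
- destruct (cos_taylor_bounds 1.31815); lra.
Qed.

(** If cos (2h) = 1/4, then cos h ^ 2 = 5/8 and sin h ^ 2 = 3/8, so
    tan h ^ 2 = 3/5. *)
Lemma tan_half_acos_quarter : 0.77459 < tan (1 / 2 * acos (1 / 4)) < 0.7746.
Proof.
destruct acos_quarter_bounds.
pose proof (cos_acos (1 / 4) ltac:(lra)) as E.
replace (acos (1 / 4)) with (2 * (1 / 2 * acos (1 / 4))) in E at 1 by field.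
set (h := 1 / 2 * acos (1 / 4)) in *.
assert (c0 : 0 < cos h) by (apply cos_gt_0; unfold h; lra).
assert (s0 : 0 < sin h) by (apply sin_gt_0; unfold h; lra).
rewrite cos_2a_cos in E.
pose proof (sin2_cos2 h) as P; unfold Rsqr in P.
assert (t0 : 0 < tan h) by now apply Rdiv_lt_0_compat.
assert (T : tan h * cos h = sin h) by (unfold tan; field; lra).
assert (tan h * tan h = 3 / 5) by nra.
nra.
Qed.

(** * The limits *)

Theorem proposition6 (l1 : nat -> nat)
  (l1_first : forall n : nat, (4 <= n)%nat -> first_hopf_index n (l1 n)) :
  (forall (n : nat) (T : R), (4 <= n)%nat ->
     hopf_period n (l1 n) T <-> T = 2 * PI * tan (PI * INR (l1 n) / INR n)) /\
  is_lim_seq (fun n : nat => 2 * PI * tan (PI * INR (l1 n) / INR n))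
             (Finite (2 * PI * tan (1 / 2 * acos (1 / 4)))) /\
  Rabs (2 * PI * tan (1 / 2 * acos (1 / 4)) - 4867 / 1000) < 5 / 10000 /\
  is_lim_seq (fun n : nat => INR n / INR (l1 n))
             (Finite (2 * PI / acos (1 / 4))) /\
  Rabs (2 * PI / acos (1 / 4) - 4767 / 1000) < 5 / 10000.
Proof.
pose proof (angle_first_hopf_lim l1 l1_first) as lim.
destruct acos_quarter_bounds as [a0 a1].
pose proof PI_bounds as piB.
pose proof acos_quarter_numeric as aB.
pose proof tan_half_acos_quarter as tB.
repeat split.
- apply hopf_periodP; now apply l1_first.
- apply hopf_periodP; now apply l1_first.
- apply (is_lim_seq_scal_l _ (2 * PI) (tan (1 / 2 * acos (1 / 4)))).
  apply is_lim_seq_ext with (fun n => tan (1 / 2 * angle n (l1 n))).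
  { intros n; rewrite half_angle; f_equal; field. }
  apply is_lim_seq_continuous.
  + apply derivable_continuous_pt, derivable_pt_tan; lra.
  + apply (is_lim_seq_scal_l _ (1 / 2) (acos (1 / 4))); exact lim.
- apply Rabs_def1; nra.
- apply is_lim_seq_ext_loc with (fun n => 2 * PI / angle n (l1 n)).
  + exists 4%nat; intros n n4.
    destruct (l1_first n n4) as (l0 & ln & _).
    unfold angle; field; repeat split; try apply not_0_INR; try lia; lra.
  + apply is_lim_seq_div'; [apply is_lim_seq_const | exact lim | lra].
- assert (E : 2 * PI / acos (1 / 4) * acos (1 / 4) = 2 * PI) by (field; lra).
  apply Rabs_def1; nra.
Qed.
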